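(* Let $ABC$ be a triangle and $P$ a point not on the extended sides of $ABC$ or of its anticomplementary triangle. Assume that $P$ is a point for which the generalized circumcenter $O$ is not the midpoint of any side of $ABC$, so that the generalized orthocenter $H$ does not coincide with any of the vertices $A,B,C$. Let $\tilde{\mathcal{C}}_O$ be the unique circumconic of $ABC$ with center $O$. Then the $9$-point conic $\mathcal{N}_H$ (with respect to $l_\infty$) of the quadrangle $ABCH$ is the complement $K(\tilde{\mathcal{C}}_O)$ of $\tilde{\mathcal{C}}_O$ with respect to $ABC$. It is also the image of $\tilde{\mathcal{C}}_O$ under a homothety $\textsf{H}$ centered at $H$ with factor $1/2$. Its center is the midpoint $N$ of segment $HO$.
   Context: We work in the Euclidean plane extended by the line at infinity $l_\infty$; affine maps act on the extended plane. Two lines are parallel if they meet $l_\infty$ in the same point (a line is parallel to itself). Products of lines such as $AP\cdot BC$ denote intersection points. The center of a conic is the pole of $l_\infty$ with respect to it. $ABC$ is a triangle with centroid $G$; $D_0,E_0,F_0$ are the midpoints of $BC,CA,AB$. $K$ is the complement map, the homothety with center $G$ and ratio $-1/2$; $K^{-1}(ABC)$ is the anticomplementary triangle. $D=AP\cdot BC$, $E=BP\cdot CA$, $F=CP\cdot AB$ are the traces of $P$. $P'$ is the isotomic conjugate of $P$: if $D_3,E_3,F_3$ are the reflections of $D,E,F$ in $D_0,E_0,F_0$, the lines $AD_3,BE_3,CF_3$ concur in $P'$. $Q=K(P')$. $T_{P'}$ is the unique affine map taking $A,B,C$ to $D_3,E_3,F_3$, respectively. The generalized circumcenter $O$ of $P$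 is the point for which $OD_0,OE_0,OF_0$ are parallel respectively to $QD,QE,QF$; the generalized orthocenter $H$ is the point for which $HA,HB,HC$ are parallel respectively to $QD,QE,QF$. One has $O=T_{P'}^{-1}K(Q)$ and $H=K^{-1}(O)$. The circumconic $\tilde{\mathcal{C}}_O$ equals $T_{P'}^{-1}(\mathcal{N}_{P'})$, where $\mathcal{N}_{P'}$ is the nine-point conic of the quadrangle $ABCP'$. The nine-point conic of a quadrangle with respect to $l_\infty$ is the conic through its three diagonal points and the midpoints of its six sides; equivalently, it is the locus of centers of the conics through its four vertices. In particular, $\mathcal{N}_H$ is the conic through the midpoints $D_0,E_0,F_0$ of the sides of $ABC$, the midpoints of $AH,BH,CH$, and the traces of $H$ on $BC,CA,AB$. *)

(* Defs.v *)
From mathcomp Require Import all_boot all_order all_algebra.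
From mathcomp Require Import classical_sets reals.

Set Implicit Arguments.
Unset Strict Implicit.
Unset Printing Implicit Defensive.

Import Order.TTheory GRing.Theory Num.Theory.
Local Open Scope ring_scope.
Local Open Scope classical_set_scope.

(* The extended plane is the projective plane of R^2 x R: its points and lines
   are the subspaces of dimension 1 and 2, joins and intersections are sums and
   intersections of subspaces, incidence is inclusion.  An ordinary point
   x : 'rV_2 is the span of (x, 1); the line at infinity is the set of vectors
   whose last coordinate vanishes. *)
Notation flat R := {vspace 'rV[R]_(2 + 1)}.

Section ExtendedPlane.
Variable R : realType.
Implicit Types (x c : 'rV[R]_2) (v : 'rV[R]_(2 + 1)) (X Y : flat R).

Definition wt v : R := rsubmx v 0 0.

Definition linfty : flat R := lker (linfun (@rsubmx R 1 2 1)).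

Definition pt x : flat R := <[row_mx x 1%:M]>%VS.

Definition is_point X : Prop := \dim X = 1%N.

(* The line through X parallel to the line l. *)
Definition parallel_through X (l : flat R) : flat R :=
  (X + (l :&: linfty))%VS.

(* The homothety y |-> c + k (y - c) of the ordinary plane, in homogeneous
   coordinates, as a linear map acting on the flats by direct image. *)
Definition homothety c (k : R) : 'End('rV[R]_(2 + 1)) :=
  linfun (mulmxr (block_mx k%:M 0 ((1 - k) *: c) 1%:M)).

(* On ordinary points this is the usual midpoint (midpoint_pt below).  If
   exactly one of X, Y lies at infinity it is that point, which is the harmonic
   conjugate, with respect to X and Y, of the point at infinity of line XY.  The
   case X = Y only matters when X is at infinity.  The result does not depend
   on the representatives of X and Y. *)
Definition midpoint X Y : flat R :=
  if X == Y then X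
  else let x := vpick X in let y := vpick Y in
       <[wt y *: x + wt x *: y]>%VS.

(* Conics are nondegenerate and have real points; they are sets of points. *)
Definition conic_points (M : 'M[R]_(2 + 1)) : set (flat R) :=
  [set X | is_point X /\ forall v, v \in X -> v *m M *m v^T = 0].

Definition conic_form (S : set (flat R)) (M : 'M[R]_(2 + 1)) : Prop :=
  [/\ M^T = M, M \in unitmx, S = conic_points M & S !=set0].

Definition is_conic (S : set (flat R)) : Prop := exists M, conic_form S M.

Definition is_pole (M : 'M[R]_(2 + 1)) (l X : flat R) : Prop :=
  is_point X /\
  forall v w, v \in X -> w \in l -> v *m M *m w^T = 0.

Definition is_center (S : set (flat R)) X : Prop :=
  exists M, conic_form S M /\ is_pole M linfty X.

Definition act (f : 'End('rV[R]_(2 + 1))) (S : set (flat R)) : set (flat R) :=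
  [set (f @: X)%VS | X in S].

Definition is_nine_point_conic (X1 X2 X3 X4 : flat R) (S : set (flat R)) :
    Prop :=
  [/\ is_conic S,
      [/\ S (midpoint X1 X2), S (midpoint X1 X3) & S (midpoint X2 X3)],
      [/\ S (midpoint X1 X4), S (midpoint X2 X4) & S (midpoint X3 X4)] &
      [/\ S ((X1 + X4) :&: (X2 + X3))%VS, S ((X2 + X4) :&: (X3 + X1))%VS
        & S ((X3 + X4) :&: (X1 + X2))%VS]].

End ExtendedPlane.

Section Triangle.
Variable R : realType.
Variables a b c : 'rV[R]_2.
Implicit Types P : flat R.

Local Notation A := (pt a).
Local Notation B := (pt b).
Local Notation C := (pt c).

Definition is_triangle : Prop := (A + B + C)%VS = fullv.

Definition centroid : 'rV[R]_2 := 3^-1 *: (a + b + c).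

Definition compl : 'End('rV[R]_(2 + 1)) := homothety centroid (- 2^-1).
Definition anticompl : 'End('rV[R]_(2 + 1)) := homothety centroid (- 2).

Definition on_sides (X Y Z P : flat R) : Prop :=
  [\/ (P <= Y + Z)%VS, (P <= Z + X)%VS | (P <= X + Y)%VS].

Definition admissible P : Prop :=
  [/\ is_point P, ~ on_sides A B C P &
      ~ on_sides (anticompl @: A)%VS (anticompl @: B)%VS (anticompl @: C)%VS P].

Definition mid (x y : 'rV[R]_2) : 'rV[R]_2 := 2^-1 *: (x + y).

Definition traceA P : flat R := ((A + P) :&: (B + C))%VS.
Definition traceB P : flat R := ((B + P) :&: (C + A))%VS.
Definition traceC P : flat R := ((C + P) :&: (A + B))%VS.

(* The homothety of ratio -1 is the reflection in its center. *)
Definition isotomic P : flat R :=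
  ((A + homothety (mid b c) (- 1) @: traceA P)
   :&: (B + homothety (mid c a) (- 1) @: traceB P)
   :&: (C + homothety (mid a b) (- 1) @: traceC P))%VS.

Definition isotomcomplement P : flat R := (compl @: isotomic P)%VS.

Definition gen_concurrence (X Y Z P : flat R) : flat R :=
  let Q := isotomcomplement P in
  (parallel_through X (Q + traceA P)
   :&: parallel_through Y (Q + traceB P)
   :&: parallel_through Z (Q + traceC P))%VS.

(* The points O and H are given by the lines through the midpoints of the sides,
   resp. the vertices, parallel to QD, QE, QF; in this form O (resp. H) may also
   be a midpoint of a side (resp. a vertex). *)
Definition gen_circumcenter P : flat R :=
  gen_concurrence (pt (mid b c)) (pt (mid c a)) (pt (mid a b)) P.

Definition gen_orthocenter P : flat R := gen_concurrence A B C P.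

Definition is_circumconic_centered (O : flat R) (S : set (flat R)) : Prop :=
  [/\ S A, S B, S C & is_center S O].

End Triangle.

Section OrdinaryPoints.
Variable R : realType.
Implicit Types x y c : 'rV[R]_2.

Lemma homothety_pt c k x :
  (homothety c k @: pt x)%VS = pt (c + k *: (x - c)).
Proof.
rewrite /pt limg_line /homothety lfunE /= mul_row_block mulmx0 add0r !mul1mx.
congr (<[row_mx _ _]>%VS).
by rewrite mul_mx_scalar scalerBl scale1r scalerBr addrCA.
Qed.

Lemma midpoint_pt x y : midpoint (pt x) (pt y) = pt (mid x y).
Proof.
have vpick_pt (z : 'rV[R]_2) :
    exists2 k, k != 0 & vpick (pt z) = k *: row_mx z 1%:M.
  have /vlineP[k Ek] := memv_pick (pt z); exists k => //.
  apply/negP => /eqP k0; move/eqP: Ek; rewrite k0 scale0r vpick0.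
  rewrite -dimv_eq0 dim_vline eqb0 negbK => /eqP/(congr1 rsubmx).
  by rewrite row_mxKr => /rowP/(_ 0)/eqP; rewrite !mxE oner_eq0.
have half (z : 'rV[R]_2) : mid z z = z.
  by rewrite /mid -mulr2n -scaler_nat scalerA mulVf ?pnatr_eq0 ?scale1r.
have pt_inj : injective (@pt R).
  move=> u v /eqP; rewrite eqEsubv => /andP[/vlineP[k] + _].
  rewrite scale_row_mx => /eq_row_mx[-> /rowP/(_ 0)].
  by rewrite !mxE mulr1 => <-; rewrite scale1r.
rewrite /midpoint; case: eqP => [/pt_inj -> | _]; first by rewrite half.
have [[k k0 ->] [l l0 ->]] := (vpick_pt x, vpick_pt y).
have wtE (t : R) (z : 'rV[R]_2) : wt (t *: row_mx z 1%:M) = t.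
  by rewrite /wt scale_row_mx row_mxKr !mxE mulr1.
rewrite /= !wtE !scalerA [l * k]mulrC -scalerDr add_row_mx.
have -> : row_mx (x + y) (1%:M + 1%:M) = 2 *: row_mx (mid x y) 1%:M.
  rewrite scale_row_mx /mid scalerA divff ?pnatr_eq0 // scale1r.
  by rewrite scaler_nat mulr2n.
have kl0 : k * l * 2 != 0 by rewrite !mulf_neq0 ?pnatr_eq0.
rewrite scalerA; apply/eqP; rewrite eqEsubv /pt -!memvE memvZ ?memv_line //=.
by apply/vlineP; exists (k * l * 2)^-1; rewrite scalerA mulVf // scale1r.
Qed.

End OrdinaryPoints.

(* Main.v *)
Require Import Defs.
From mathcomp Require Import all_boot all_order all_algebra.
From mathcomp Require Import classical_sets reals.
From mathcomp Require Import ring lra.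

(* In barycentric coordinates with respect to ABC, write P = (x : y : z),
   s = xy + yz + zx and (dx, dy, dz) = (x^2 - s, y^2 - s, z^2 - s).  Then
   Q = (x(y+z) : y(z+x) : z(x+y)), the points at infinity of QD, QE, QF are
   polynomial in x, y, z, and this gives
   O = (x(y+z)^2 dx : y(z+x)^2 dy : z(x+y)^2 dz) and
   H = (x dy dz : y dz dx : z dx dy).
   No two of dx, dy, dz vanish, and O is a midpoint of a side iff one of them
   does; so H = (u : v : w) with nonzero coordinates and nonzero pairwise sums,
   and O = (v+w : w+u : u+v) = K(H).  The conic with center O through A, B, C is
   u(v+w) yz + v(w+u) zx + w(u+v) xy = 0, and the nine points force the conic
   x(x-y-z)/u + y(y-z-x)/v + z(z-x-y)/w = 0.  The images of the circumconic
   under the complement map and under the homothety centered at H pass through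
   the nine points, hence coincide with it. *)

Set Implicit Arguments.
Unset Strict Implicit.
Unset Printing Implicit Defensive.

Import Order.TTheory GRing.Theory Num.Theory.
Local Open Scope ring_scope.
Local Open Scope classical_set_scope.

(** * Bilinear forms of conics and the action of homotheties *)

Section ConicForms.
Variable R : realType.
Implicit Types (M F : 'M[R]_(2 + 1)) (v w : 'rV[R]_(2 + 1)) (c : 'rV[R]_2)
  (k : R) (S : set (flat R)) (X : flat R).

(** The entry of the 1 by 1 product is taken so that incidence and polarity become equations in [R],
    accessible to [ring] and [field]. *)
Definition bform M v w : R := (v *m M *m w^T) 0 0.

Lemma bformE M v w : (v *m M *m w^T = 0) <-> bform M v w = 0.
Proof.
rewrite /bform; split=> [-> | e]; first by rewrite mxE.
by apply/rowP => i; rewrite ord1 e mxE.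
Qed.

Lemma bformDl M v v' w : bform M (v + v') w = bform M v w + bform M v' w.
Proof. by rewrite /bform !mulmxDl mxE. Qed.

Lemma bformZl M k v w : bform M (k *: v) w = k * bform M v w.
Proof. by rewrite /bform -!scalemxAl mxE. Qed.

Lemma bformDr M v w w' : bform M v (w + w') = bform M v w + bform M v w'.
Proof. by rewrite /bform linearD mulmxDr mxE. Qed.

Lemma bformZr M k v w : bform M v (k *: w) = k * bform M v w.
Proof. by rewrite /bform linearZ /= -scalemxAr mxE. Qed.

Lemma bformC M v w : M^T = M -> bform M v w = bform M w v.
Proof.
move=> sM; rewrite /bform.
have -> : w *m M *m v^T = (v *m M *m w^T)^T by rewrite !trmx_mul trmxK sM
  mulmxA.
by rewrite [RHS]mxE.
Qed.

Lemma is_point_line v : v != 0 -> is_point <[v]>%VS.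
Proof. by rewrite /is_point dim_vline => ->. Qed.

Lemma is_pointP X : is_point X -> exists2 v, v != 0 & X = <[v]>%VS.
Proof.
move=> dX; have nX : X != 0%VS by rewrite -dimv_eq0 dX.
exists (vpick X); first by rewrite vpick0.
apply/eqP; rewrite eq_sym eqEdim -memvE memv_pick /= dX dim_vline.
by rewrite vpick0 nX.
Qed.

Lemma vline_scale k v : k != 0 -> <[k *: v]>%VS = <[v]>%VS.
Proof.
move=> k0; apply/eqP; rewrite eqEsubv -!memvE memvZ ?memv_line //=.
by apply/vlineP; exists k^-1; rewrite scalerA mulVf ?scale1r.
Qed.

(** One spanning vector suffices, because the form is quadratic and a point consists of the
    multiples of that vector. *)
Lemma conic_points_line M v :
  v != 0 -> conic_points M <[v]>%VS <-> bform M v v = 0.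
Proof.
move=> nv; split=> [[_ /(_ v (memv_line v)) /bformE //] | e].
split=> [|_ /vlineP[k ->]]; first exact: is_point_line.
by apply/bformE; rewrite bformZl bformZr e !mulr0.
Qed.

Lemma conic_points_eq M N k : k != 0 ->
  (forall v, bform M v v = k * bform N v v) -> conic_points M = conic_points N.
Proof.
move=> k0 e; apply/seteqP; split=> X [pX MX]; split=> // v /MX /bformE.
  by rewrite e => /eqP; rewrite mulf_eq0 (negPf k0) => /eqP/bformE.
by move=> f; apply/bformE; rewrite e f mulr0.
Qed.

(* v |-> v F maps the conic with matrix M to the one with matrix
   F^-1 M F^-T. *)
Lemma act_conic (f : 'End('rV[R]_(2 + 1))) F M S :
  F \in unitmx -> (forall v, f v = v *m F) -> conic_form S M ->
  exists2 N, conic_form (act f S) N &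
    forall v w, bform N (f v) (f w) = bform M v w.
Proof.
move=> uF fE [sM uM -> [X0 X0M]].
set N := invmx F *m M *m (invmx F)^T.
have formf v w : bform N (f v) (f w) = bform M v w.
  by rewrite /bform /N !fE trmx_mul trmx_inv !mulmxA mulmxK // mulmxKV
    ?unitmx_tr.
have f0 v : (f v == 0) = (v == 0).
  rewrite fE; apply/eqP/eqP=> [e|->]; last by rewrite mul0mx.
  by rewrite -[v](mulmxK uF) e mul0mx.
exists N => //; split; first by rewrite !trmx_mul trmxK sM mulmxA.
- by rewrite !unitmx_mul unitmx_tr unitmx_inv uF uM.
- apply/seteqP; split=> [_ [X [pX qX] <-] | X [pX qX]].
    have [v nv EX] := is_pointP pX; rewrite EX limg_line.
    apply/conic_points_line; rewrite ?f0 // formf; apply/bformE/qX.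
    by rewrite EX memv_line.
  have [v nv EX] := is_pointP pX.
  have Ev : v = f (v *m invmx F) by rewrite fE mulmxKV.
  exists <[v *m invmx F]>%VS; last by rewrite limg_line -Ev.
  apply/conic_points_line; first by rewrite -f0 -Ev.
  by rewrite -formf -Ev; apply/bformE/qX; rewrite EX memv_line.
by exists (f @: X0)%VS; exists X0.
Qed.

Lemma wtD v w : wt (v + w) = wt v + wt w.
Proof. by rewrite /wt linearD mxE. Qed.

Lemma wtZ k v : wt (k *: v) = k * wt v.
Proof. by rewrite /wt linearZ mxE. Qed.

Lemma memv_linfty v : (v \in linfty R) = (wt v == 0).
Proof.
rewrite /linfty memv_ker lfunE /wt /=; apply/eqP/eqP => [-> | e].
  by rewrite mxE.
by apply/rowP => i; rewrite ord1 e mxE.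
Qed.

(** The center enters multiplied by the weight of [v], so the formula covers directions too: on
    vectors of weight 0 the map is multiplication by [k]. *)
Lemma homothetyE c k v :
  homothety c k v = k *: v + ((1 - k) * wt v) *: row_mx c 1%:M.
Proof.
have Ev : v = row_mx (lsubmx v) (wt v)%:M.
  rewrite -[LHS]hsubmxK; congr row_mx.
  by apply/matrixP=> i j; rewrite !ord1 /wt [RHS]mxE eqxx.
rewrite /homothety lfunE /= {1}Ev mul_row_block mulmx0 add0r mulmx1.
rewrite mul_mx_scalar -scalemxAr mul_scalar_mx [in X in _ = k *: X + _]Ev.
rewrite !scale_row_mx add_row_mx !scalerA; congr row_mx.
by rewrite scalemx1 scale_scalar_mx -raddfD; congr (_%:M); ring.
Qed.

Lemma wt_homothety c k v : wt (homothety c k v) = wt v.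
Proof.
rewrite homothetyE wtD !wtZ {3}/wt row_mxKr mxE /=; ring.
Qed.

Lemma homothetyK c k : k != 0 ->
  cancel (homothety c k) (homothety c k^-1).
Proof.
move=> k0 v; rewrite homothetyE wt_homothety homothetyE scalerDr !scalerA.
rewrite mulVf // scale1r -addrA -scalerDl.
have -> : k^-1 * ((1 - k) * wt v) + (1 - k^-1) * wt v = 0 by field.
by rewrite scale0r addr0.
Qed.

Lemma homothetyVK c k : k != 0 ->
  cancel (homothety c k^-1) (homothety c k).
Proof.
by move=> k0; have := @homothetyK c k^-1; rewrite invrK invr_eq0; apply.
Qed.

Lemma homothety_conic_form c k S M : k != 0 -> conic_form S M ->
  exists2 N, conic_form (act (homothety c k) S) N &
    forall v w, bform N (homothety c k v) (homothety c k w) = bform M v w.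
Proof.
move=> k0; pose F l := block_mx l%:M 0 ((1 - l) *: c) (1%:M : 'M[R]_1).
have fE l v : homothety c l v = v *m F l by rewrite /homothety lfunE.
apply: act_conic (fE k).
(* Row i of the product is the image of the i-th basis vector under two mutually inverse
   homotheties. *)
suff /mulmx1_unit[] : F k *m F k^-1 = 1%:M by [].
by apply/row_matrixP=> i; rewrite row_mul rowE -2!fE homothetyK // rowE mulmx1.
Qed.

Lemma homothety_linfty c k : k != 0 ->
  (homothety c k @: linfty R)%VS = linfty R.
Proof.
move=> k0; apply/vspaceP=> v; apply/memv_imgP/idP=> [[w lw ->] | lv].
  by move: lw; rewrite !memv_linfty wt_homothety.
exists (homothety c k^-1 v); last by rewrite homothetyVK.
by move: lv; rewrite !memv_linfty wt_homothety.
Qed.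

(** The form is transported to the image conic and the line at infinity is preserved, hence so is
    the pole relation between them. *)
Lemma homothety_center c k S X : k != 0 -> is_center S X ->
  is_center (act (homothety c k) S) (homothety c k @: X)%VS.
Proof.
move=> k0 [M [MS [pX polX]]].
have [N NS fN] := homothety_conic_form c k0 MS.
exists N; split=> //; split.
  have [v nv ->] := is_pointP pX; rewrite limg_line; apply: is_point_line.
  apply: contraNneq nv => e; rewrite -[v](homothetyK c k0) e linear0 //.
move=> _ w /memv_imgP[v Xv ->]; rewrite -(homothety_linfty c k0).
by move=> /memv_imgP[w' lw ->]; apply/bformE; rewrite fN; apply/bformE/polX.
Qed.

Lemma act_homothetyP c k S X : k != 0 ->
  S (homothety c k^-1 @: X)%VS -> act (homothety c k) S X.
Proof.
move=> k0 SX; exists (homothety c k^-1 @: X)%VS => //.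
by rewrite -limg_comp; apply/vspaceP=> v; apply/memv_imgP/idP=> [[w Xw ->]|Xv];
  [| exists v => //]; rewrite lfunE /= homothetyVK.
Qed.

(** [vpick] yields unknown nonzero multiples of [v] and [w]; since each summand contains both
    vectors once, they only contribute a common nonzero factor. *)
Lemma midpoint_line v w : v != 0 -> w != 0 -> <[v]>%VS != <[w]>%VS ->
  midpoint <[v]>%VS <[w]>%VS = <[wt w *: v + wt v *: w]>%VS.
Proof.
move=> nv nw /negPf vw; rewrite /midpoint vw.
have pick (u : 'rV[R]_(2 + 1)) : u != 0 -> exists2 k, k != 0 & vpick <[u]>%VS =
  k *: u.
  move=> nu; have /vlineP[k Ek] := memv_pick <[u]>%VS; exists k => //.
  have: vpick <[u]>%VS != 0 by rewrite vpick0 -dimv_eq0 dim_vline nu.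
  by rewrite Ek; apply: contraNneq => ->; rewrite scale0r.
have [[k k0 ->] [l l0 ->]] := (pick v nv, pick w nw).
rewrite /= !wtZ !scalerA -[RHS](vline_scale _ (mulf_neq0 k0 l0)) scalerDr
  !scalerA.
by congr (<[_ *: _ + _ *: _]>%VS); ring.
Qed.

Lemma act_homothety_line c k S M v : k != 0 -> conic_form S M -> v != 0 ->
  bform M (homothety c k^-1 v) (homothety c k^-1 v) = 0 ->
  act (homothety c k) S <[v]>%VS.
Proof.
move=> k0 [_ _ -> _] nv e; apply: act_homothetyP => //; rewrite limg_line.
apply/conic_points_line => //; apply: contraNneq nv => e0.
by rewrite -[v](homothetyVK c k0) e0 linear0.
Qed.

(** Basis vectors in the second slot read off the entries of [v *m M]. This excludes the factor 0
    once a form is known up to a factor. *)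
Lemma bform_nondegenerate M v : M \in unitmx ->
  (forall w, bform M v w = 0) -> v = 0.
Proof.
move=> uM e; rewrite -[v](mulmxK uM); suff -> : v *m M = 0 by rewrite mul0mx.
apply/rowP=> j; have := e (delta_mx 0 j).
by rewrite /bform trmx_delta -colE !mxE.
Qed.

Lemma bform_polar M v w : M^T = M ->
  2 * bform M v w = bform M (v + w) (v + w) - bform M v v - bform M w w.
Proof.
by move=> sM; rewrite !bformDl !bformDr (bformC w v sM); ring.
Qed.

End ConicForms.

(** * Barycentric coordinates; joins and meets of lines *)

Definition bary (R : realType) (a b c : 'rV[R]_2) (x y z : R) :
    'rV[R]_(2 + 1) :=
  x *: row_mx a 1%:M + y *: row_mx b 1%:M + z *: row_mx c 1%:M.

Section Barycentric.
Variables (R : realType) (a b c : 'rV[R]_2).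
Hypothesis abc : is_triangle a b c.
Local Notation bary := (bary a b c).
Local Notation bpt x y z := <[bary x y z]>%VS.
Implicit Types (x y z p q r k : R) (L : flat R) (S : set (flat R)).

Lemma ptA : pt a = bpt 1 0 0.
Proof. by rewrite /pt /bary scale1r !scale0r !addr0. Qed.

Lemma ptB : pt b = bpt 0 1 0.
Proof. by rewrite /pt /bary scale1r !scale0r add0r addr0. Qed.

Lemma ptC : pt c = bpt 0 0 1.
Proof. by rewrite /pt /bary scale1r !scale0r !add0r. Qed.

Lemma baryZ k x y z : k *: bary x y z = bary (k * x) (k * y) (k * z).
Proof. by rewrite /bary !scalerDr !scalerA. Qed.

Lemma baryD x y z p q r :
  bary x y z + bary p q r = bary (x + p) (y + q) (z + r).
Proof. by rewrite /bary !scalerDl addrACA; congr (_ + _); rewrite addrACA. Qed.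

(** The three vectors span the whole space, whose dimension is 3, so they are independent. *)
Lemma bary_free x y z : bary x y z = 0 -> [/\ x = 0, y = 0 & z = 0].
Proof.
pose X := [:: row_mx a (1%:M : 'M_1); row_mx b 1%:M; row_mx c 1%:M].
have /freeP fX : free (in_tuple X).
  rewrite /free /= !span_cons span_nil addv0 addvA.
  by rewrite -[(_ + _)%VS]/(pt a + pt b + pt c)%VS abc dimvf.
move=> e; have := fX (fun i => nth 0 [:: x; y; z] i).
rewrite !big_ord_recl big_ord0 addr0 addrA /= => /(_ e) k0.
by split; [apply: (k0 (@Ordinal 3 0 isT)) | apply: (k0 (@Ordinal 3 1 isT)) |
  apply: (k0 (@Ordinal 3 2 isT))].
Qed.

Lemma bary_inj x y z p q r : bary x y z = bary p q r ->
  [/\ x = p, y = q & z = r].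
Proof.
move/eqP; rewrite -subr_eq0 -scaleN1r baryZ baryD => /eqP/bary_free[].
by rewrite !mulN1r => /subr0_eq-> /subr0_eq-> /subr0_eq->.
Qed.

Lemma bary_surj v : exists x y z, v = bary x y z.
Proof.
have : v \in (pt a + pt b + pt c)%VS by rewrite abc memvf.
case/memv_addP=> _ /memv_addP[_ /vlineP[x ->] [_ /vlineP[y ->] ->]].
by case=> _ /vlineP[z ->] ->; exists x, y, z.
Qed.

Lemma bary_neq0 x y z : (bary x y z != 0) = [|| x != 0, y != 0 | z != 0].
Proof.
rewrite -!negb_and; congr (~~ _); apply/eqP/and3P=> [/bary_free[-> -> ->] |].
  by split.
by case=> /eqP-> /eqP-> /eqP->; rewrite /bary !scale0r !addr0.
Qed.

Lemma wt_bary x y z : wt (bary x y z) = x + y + z.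
Proof. by rewrite !wtD !wtZ /wt !row_mxKr !mxE /= !mulr1. Qed.

Lemma bpt_eq k x y z p q r : k != 0 -> x = k * p -> y = k * q -> z = k * r ->
  bpt x y z = bpt p q r.
Proof. by move=> k0 -> -> ->; rewrite -baryZ vline_scale. Qed.

Lemma memv_bpt x y z p q r : (bary x y z \in bpt p q r) ->
  exists k, [/\ x = k * p, y = k * q & z = k * r].
Proof. by case/vlineP=> k; rewrite baryZ => /bary_inj; exists k. Qed.

(** Coefficients of an equation represent a line, so that joins and meets both become cross
    products. *)
Definition is_line L (l : R * R * R) := forall x y z,
  (bary x y z \in L) = (l.1.1 * x + l.1.2 * y + l.2 * z == 0).

Lemma linfty_line : is_line (linfty R) (1, 1, 1).
Proof. by move=> x y z; rewrite memv_linfty wt_bary !mul1r. Qed.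

Lemma is_line_scale k L l p q r : k != 0 -> is_line L l ->
  l = (k * p, k * q, k * r) -> is_line L (p, q, r).
Proof.
move=> k0 Ll e x y z; rewrite Ll e /=.
by rewrite -[RHS](mulrI_eq0 _ (mulfI k0)) !mulrDr !mulrA.
Qed.

Lemma join_line x y z p q r (l := (y * r - z * q, z * p - x * r, x * q - y *
  p)) :
  [|| l.1.1 != 0, l.1.2 != 0 | l.2 != 0] -> is_line (bpt x y z + bpt p q r) l.
Proof.
move=> l0 s t u; apply/idP/idP.
  case/memv_addP=> _ /vlineP[i ->] [_ /vlineP[j ->]].
  by rewrite !baryZ baryD => /bary_inj[-> -> ->]; apply/eqP; rewrite /l /=;
    ring.
move/eqP=> e.
have span i j : s = i * x + j * p -> t = i * y + j * q -> u = i * z + j * r ->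
    bary s t u \in (bpt x y z + bpt p q r)%VS.
  by move=> -> -> ->; rewrite -baryD -!baryZ memv_add ?memvZ ?memv_line.
(* Cramer's rule on the two coordinates whose minor is nonzero gives the two multipliers; the third
   coordinate then agrees by the line equation [e]. *)
move: l0 e; rewrite /l /= => /or3P[] n e.
- by apply: (span ((t * r - u * q) / (y * r - z * q))
    ((y * u - z * t) / (y * r - z * q))); apply: (mulfI n);
    apply/eqP; rewrite -subr_eq0; apply/eqP;
    first [by field | by rewrite -[RHS]e; field].
- by apply: (span ((u * p - s * r) / (z * p - x * r))
    ((z * s - x * u) / (z * p - x * r))); apply: (mulfI n);
    apply/eqP; rewrite -subr_eq0; apply/eqP;
    first [by field | by rewrite -[RHS]e; field].
- by apply: (span ((s * q - t * p) / (x * q - y * p))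
    ((x * t - y * s) / (x * q - y * p))); apply: (mulfI n);
    apply/eqP; rewrite -subr_eq0; apply/eqP;
    first [by field | by rewrite -[RHS]e; field].
Qed.

Lemma meet_line L M (l m : R * R * R)
    (p := (l.1.2 * m.2 - l.2 * m.1.2, l.2 * m.1.1 - l.1.1 * m.2,
           l.1.1 * m.1.2 - l.1.2 * m.1.1)) :
  is_line L l -> is_line M m -> [|| p.1.1 != 0, p.1.2 != 0 | p.2 != 0] ->
  (L :&: M)%VS = bpt p.1.1 p.1.2 p.2.
Proof.
move=> Ll Mm p0; apply/vspaceP=> v; have [x [y [z ->]]] := bary_surj v.
rewrite memv_cap Ll Mm; apply/andP/idP=> [[/eqP e /eqP f] | ].
  (* Proportionality of (x, y, z) and the cross product: each 2 by 2 minor is a combination of the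
     two line equations, whose zeros are rewritten backwards. *)
  have xy : p.1.1 * y = p.1.2 * x.
    apply: subr0_eq; transitivity (m.2 * 0 - l.2 * 0);
      last by rewrite !mulr0 subrr.
    by rewrite -{1}e -{1}f /p /=; ring.
  have yz : p.1.2 * z = p.2 * y.
    apply: subr0_eq; transitivity (m.1.1 * 0 - l.1.1 * 0);
      last by rewrite !mulr0 subrr.
    by rewrite -{1}e -{1}f /p /=; ring.
  have zx : p.2 * x = p.1.1 * z.
    apply: subr0_eq; transitivity (m.1.2 * 0 - l.1.2 * 0);
      last by rewrite !mulr0 subrr.
    by rewrite -{1}e -{1}f /p /=; ring.
  have on k : x = k * p.1.1 -> y = k * p.1.2 -> z = k * p.2 ->
      bary x y z \in bpt p.1.1 p.1.2 p.2.
    by move=> -> -> ->; rewrite -baryZ memvZ ?memv_line.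
  case/or3P: p0 => n.
  - by apply: (on (x / p.1.1)); apply: (mulfI n); rewrite ?xy -?zx; field.
  - by apply: (on (y / p.1.2)); apply: (mulfI n); rewrite -?xy ?yz; field.
  - by apply: (on (z / p.2)); apply: (mulfI n); rewrite -?yz ?zx; field.
by move/memv_bpt=> [k [-> -> ->]]; split; apply/eqP; rewrite /p /=; ring.
Qed.

(** A common factor [k] of the coefficients is dropped, here and in [meet_lineE]; this keeps the
    later polynomial identities small. *)
Lemma join_lineE k x y z p q r l1 l2 l3 : k != 0 ->
  y * r - z * q = k * l1 -> z * p - x * r = k * l2 -> x * q - y * p = k * l3 ->
  [|| l1 != 0, l2 != 0 | l3 != 0] ->
  is_line (bpt x y z + bpt p q r) (l1, l2, l3).
Proof.
move=> k0 e1 e2 e3 l0; apply: (is_line_scale k0) (join_line _) _ => /=.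
  by rewrite e1 e2 e3 !mulf_eq0 (negPf k0).
by rewrite e1 e2 e3.
Qed.

Lemma meet_lineE k L M l1 l2 l3 m1 m2 m3 p q r : k != 0 ->
  is_line L (l1, l2, l3) -> is_line M (m1, m2, m3) ->
  l2 * m3 - l3 * m2 = k * p -> l3 * m1 - l1 * m3 = k * q ->
  l1 * m2 - l2 * m1 = k * r -> [|| p != 0, q != 0 | r != 0] ->
  (L :&: M)%VS = bpt p q r.
Proof.
move=> k0 Ll Mm e1 e2 e3 p0; rewrite (meet_line Ll Mm) /=.
  exact: bpt_eq k0 e1 e2 e3.
by rewrite e1 e2 e3 !mulf_eq0 (negPf k0).
Qed.

Lemma line_bc : is_line (pt b + pt c) (1, 0, 0).
Proof.
rewrite ptB ptC; apply: (join_lineE (oner_neq0 _)); rewrite ?oner_eq0 //; ring.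
Qed.

Lemma line_ca : is_line (pt c + pt a) (0, 1, 0).
Proof.
rewrite ptC ptA; apply: (join_lineE (oner_neq0 _)); rewrite ?oner_eq0 ?orbT //;
  ring.
Qed.

Lemma line_ab : is_line (pt a + pt b) (0, 0, 1).
Proof.
rewrite ptA ptB; apply: (join_lineE (oner_neq0 _)); rewrite ?oner_eq0 ?orbT //;
  ring.
Qed.

Lemma cevian_a x y z : (y != 0) || (z != 0) ->
  is_line (pt a + bpt x y z) (0, - z, y).
Proof.
move=> yz; rewrite ptA; apply: (join_lineE (oner_neq0 _)); rewrite ?oppr_eq0.
- ring.
- ring.
- ring.
- by case/orP: yz => ->; rewrite ?orbT.
Qed.

Lemma cevian_b x y z : (x != 0) || (z != 0) ->
  is_line (pt b + bpt x y z) (z, 0, - x).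
Proof.
move=> xz; rewrite ptB; apply: (join_lineE (oner_neq0 _)); rewrite ?oppr_eq0.
- ring.
- ring.
- ring.
- by case/orP: xz => ->; rewrite ?orbT.
Qed.

Lemma cevian_c x y z : (x != 0) || (y != 0) ->
  is_line (pt c + bpt x y z) (- y, x, 0).
Proof.
move=> xy; rewrite ptC; apply: (join_lineE (oner_neq0 _)); rewrite ?oppr_eq0.
- ring.
- ring.
- ring.
- by case/orP: xy => ->; rewrite ?orbT.
Qed.

(** * Traces, midpoints and complements in barycentric coordinates *)

Lemma traceA_bary x y z : (y != 0) || (z != 0) ->
  traceA a b c (bpt x y z) = bpt 0 y z.
Proof.
move=> yz; apply: (meet_lineE (oner_neq0 _)) (cevian_a x yz) line_bc _ _ _ _;
  [ring | ring | ring | by rewrite yz orbT].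
Qed.

Lemma traceB_bary x y z : (x != 0) || (z != 0) ->
  traceB a b c (bpt x y z) = bpt x 0 z.
Proof.
move=> xz; apply: (meet_lineE (oner_neq0 _)) (cevian_b y xz) line_ca _ _ _ _;
  [ring | ring | ring | by case/orP: xz => ->; rewrite ?orbT].
Qed.

Lemma traceC_bary x y z : (x != 0) || (y != 0) ->
  traceC a b c (bpt x y z) = bpt x y 0.
Proof.
move=> xy; apply: (meet_lineE (oner_neq0 _)) (cevian_c z xy) line_ab _ _ _ _;
  [ring | ring | ring | by case/orP: xy => ->; rewrite ?orbT].
Qed.

Lemma bary_vertices x y z :
  bary x y z = x *: bary 1 0 0 + y *: bary 0 1 0 + z *: bary 0 0 1.
Proof. by rewrite !baryZ !baryD !mulr0 !mulr1 !add0r !addr0. Qed.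

Lemma row_mid (x y : 'rV[R]_2) :
  row_mx (mid x y) 1%:M = 2^-1 *: (row_mx x 1%:M + row_mx y 1%:M) :> 'rV[R]_(2
    + 1).
Proof.
rewrite add_row_mx scale_row_mx /mid; congr row_mx.
by rewrite -scalemx1 -scalerDl scalerA; congr (_ *: _); field.
Qed.

Lemma mid_bc : pt (mid b c) = bpt 0 1 1.
Proof.
rewrite /pt row_mid vline_scale ?invr_neq0 ?pnatr_eq0 //.
by rewrite /bary scale0r !scale1r add0r.
Qed.

Lemma mid_ca : pt (mid c a) = bpt 1 0 1.
Proof.
rewrite /pt row_mid vline_scale ?invr_neq0 ?pnatr_eq0 //.
by rewrite /bary scale0r !scale1r addr0 addrC.
Qed.

Lemma mid_ab : pt (mid a b) = bpt 1 1 0.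
Proof.
rewrite /pt row_mid vline_scale ?invr_neq0 ?pnatr_eq0 //.
by rewrite /bary scale0r !scale1r addr0.
Qed.

Lemma homothety_bary p q r c0 k x y z : row_mx c0 1%:M = bary p q r ->
  homothety c0 k (bary x y z) =
  bary (k * x + (1 - k) * (x + y + z) * p) (k * y + (1 - k) * (x + y + z) * q)
       (k * z + (1 - k) * (x + y + z) * r).
Proof. by move=> e; rewrite homothetyE wt_bary e !baryZ baryD. Qed.

Lemma row_centroid : row_mx (centroid a b c) 1%:M = bary 3^-1 3^-1 3^-1.
Proof.
rewrite /bary !scale_row_mx !add_row_mx /centroid !scalerDr; congr row_mx.
by rewrite -!scalerDl -[LHS]scale1r; congr (_ *: _); field.
Qed.

Lemma compl_bary x y z :
  compl a b c (bary x y z) = 2^-1 *: bary (y + z) (z + x) (x + y).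
Proof.
rewrite /compl (homothety_bary _ _ _ _ row_centroid) baryZ.
by congr (bary _ _ _); field.
Qed.

Lemma anticompl_bary x y z :
  anticompl a b c (bary x y z) = bary (y + z - x) (z + x - y) (x + y - z).
Proof.
rewrite /anticompl (homothety_bary _ _ _ _ row_centroid).
by congr (bary _ _ _); field.
Qed.

(** * Equations of circumconics and of nine-point conics *)

Lemma bform_bary (M : 'M[R]_(2 + 1)) x y z p q r : M^T = M ->
  bform M (bary x y z) (bary p q r) =
    x * p * bform M (bary 1 0 0) (bary 1 0 0)
  + y * q * bform M (bary 0 1 0) (bary 0 1 0)
  + z * r * bform M (bary 0 0 1) (bary 0 0 1)
  + (y * r + z * q) * bform M (bary 0 1 0) (bary 0 0 1)
  + (z * p + x * r) * bform M (bary 1 0 0) (bary 0 0 1)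
  + (x * q + y * p) * bform M (bary 1 0 0) (bary 0 1 0).
Proof.
move=> sM; have comb (d e f : 'rV[R]_(2 + 1)) :
    bform M (x *: d + y *: e + z *: f) (p *: d + q *: e + r *: f) =
    x * p * bform M d d + y * q * bform M e e + z * r * bform M f f
    + (y * r + z * q) * bform M e f + (z * p + x * r) * bform M d f
    + (x * q + y * p) * bform M d e.
  rewrite !bformDl !bformDr !bformZl !bformZr.
  by rewrite (bformC e d sM) (bformC f d sM) (bformC f e sM); ring.
by rewrite (bary_vertices x) (bary_vertices p) comb.
Qed.

(** A bilinear form of the circumconic p yz + q zx + r xy = 0; on equal arguments it is twice the
    left side. *)
Definition circumform p q r x y z x' y' z' : R :=
  p * (y * z' + z * y') + q * (z * x' + x * z') + r * (x * y' + y * x').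

(** [N] is the matrix of the form in the basis of the vertices, and [T], with the vertices as rows,
    carries it to homogeneous coordinates. *)
Lemma circumconic_exists p q r : p != 0 -> q != 0 -> r != 0 ->
  exists M : 'M[R]_(2 + 1), [/\ M^T = M, M \in unitmx & forall x y z x' y' z',
    bform M (bary x y z) (bary x' y' z') = circumform p q r x y z x' y' z'].
Proof.
move=> p0 q0 r0.
pose T : 'M[R]_(2 + 1) := \matrix_(i < 3)
  nth 0 [:: row_mx a 1%:M; row_mx b 1%:M; row_mx c 1%:M] i.
have uT (u : 'rV[R]_3) : u *m T =
    bary (u 0 (@Ordinal 3 0 isT)) (u 0 (@Ordinal 3 1 isT)) (u 0 (@Ordinal 3 2
      isT)).
  rewrite mulmx_sum_row !big_ord_recl big_ord0 addr0 !rowK /= addrA.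
  by congr (u 0 _ *: _ + u 0 _ *: _ + u 0 _ *: _); apply/val_inj.
have unitT : T \in unitmx.
  rewrite -row_free_unit; apply: inj_row_free => u; rewrite uT.
  move/bary_free => [e0 e1 e2]; apply/rowP=> -[[|[|[|//]]] i]; rewrite [RHS]mxE;
  [rewrite -[RHS]e0 | rewrite -[RHS]e1 | rewrite -[RHS]e2];
  by congr (u 0 _); apply/val_inj.
pose N : 'M[R]_(2 + 1) := \matrix_(i < 3, j < 3)
  nth 0 (nth [::] [:: [:: 0; r; q]; [:: r; 0; p]; [:: q; p; 0]] i) j.
pose M := invmx T *m N *m (invmx T)^T.
have sM : M^T = M.
  rewrite !trmx_mul trmxK !mulmxA; congr (_ *m _ *m _).
  by apply/matrixP=> -[[|[|[|//]]] i] [[|[|[|//]]] j]; rewrite !mxE.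
have bformM (x y z x' y' z' : R) :
    bform M (bary x y z) (bary x' y' z') = circumform p q r x y z x' y' z'.
  have rowT (s t w : R) : bary s t w = (\row_(i < 3) nth 0 [:: s; t; w] i) *m T.
    by rewrite uT !mxE.
  rewrite /bform !rowT trmx_mul /M trmx_inv !mulmxA mulmxK // mulmxKV
    ?unitmx_tr //.
  rewrite /circumform.
  rewrite mxE !big_ord_recl big_ord0 !mxE !big_ord_recl !big_ord0 !mxE /=.
  ring.
exists M; split=> //.
rewrite -row_free_unit; apply: inj_row_free => v vM.
have [x [y [z Ev]]] := bary_surj v.
have e (t : 'rV[R]_(2 + 1)) : bform M v t = 0 by rewrite /bform vM mul0mx mxE.
(* Pairing a kernel vector with A, B, C gives three linear equations; their combinations isolate
   2qrx, 2pry and 2pqz. *)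
have [e1 e2 e3] : [/\ r * y + q * z = 0, r * x + p * z = 0 & q * x + p * y = 0].
  by split; [rewrite -[RHS](e (bary 1 0 0)) | rewrite -[RHS](e (bary 0 1 0)) |
    rewrite -[RHS](e (bary 0 0 1))]; rewrite Ev bformM /circumform; ring.
have [x0 y0 z0] : [/\ x = 0, y = 0 & z = 0].
  split; apply/eqP.
  - have : 2 * q * r * x = 0.
      transitivity (q * 0 + r * 0 - p * 0); last by ring.
      by rewrite -{1}e2 -{1}e3 -{1}e1; ring.
    by move/eqP; rewrite !mulf_eq0 pnatr_eq0 (negPf q0) (negPf r0).
  - have : 2 * p * r * y = 0.
      transitivity (p * 0 + r * 0 - q * 0); last by ring.
      by rewrite -{1}e1 -{1}e3 -{1}e2; ring.
    by move/eqP; rewrite !mulf_eq0 pnatr_eq0 (negPf p0) (negPf r0).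
  - have : 2 * p * q * z = 0.
      transitivity (p * 0 + q * 0 - r * 0); last by ring.
      by rewrite -{1}e1 -{1}e2 -{1}e3; ring.
    by move/eqP; rewrite !mulf_eq0 pnatr_eq0 (negPf p0) (negPf q0).
by rewrite Ev x0 y0 z0 /bary !scale0r !addr0.
Qed.

(** Passing through A, B, C leaves three mixed coefficients, and the pole condition gives two linear
    equations that fix them up to a factor. *)
Lemma circumconic_form (M : 'M[R]_(2 + 1)) S u v w :
    u != 0 -> v != 0 -> w != 0 -> v + w != 0 -> w + u != 0 -> u + v != 0 ->
    conic_form S M -> S (pt a) -> S (pt b) -> S (pt c) ->
    is_pole M (linfty R) (bpt (v + w) (w + u) (u + v)) ->
  exists2 k, k != 0 & forall x y z x' y' z',
    bform M (bary x y z) (bary x' y' z') =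
    k * circumform (u * (v + w)) (v * (w + u)) (w * (u + v)) x y z x' y' z'.
Proof.
move=> u0 v0 w0 vw wu uv [sM uM -> _]; rewrite ptA ptB ptC.
have nA : bary 1 0 0 != 0 by rewrite bary_neq0 oner_neq0.
have nB : bary 0 1 0 != 0 by rewrite bary_neq0 oner_neq0 orbT.
have nC : bary 0 0 1 != 0 by rewrite bary_neq0 oner_neq0 !orbT.
move=> /(conic_points_line _ nA) mA /(conic_points_line _ nB) mB.
move=> /(conic_points_line _ nC) mC [_ pole].
set m4 := bform M (bary 0 1 0) (bary 0 0 1).
set m5 := bform M (bary 1 0 0) (bary 0 0 1).
set m6 := bform M (bary 1 0 0) (bary 0 1 0).
have formM x y z x' y' z' :
    bform M (bary x y z) (bary x' y' z') = circumform m4 m5 m6 x y z x' y' z'.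
  by rewrite bform_bary // mA mB mC /circumform -/m4 -/m5 -/m6; ring.
pose o1 := v + w; pose o2 := w + u; pose o3 := u + v.
have polar x y z : x + y + z = 0 ->
    circumform m4 m5 m6 o1 o2 o3 x y z = 0.
  move=> e; rewrite -formM; apply/bformE/pole; first exact: memv_line.
  by rewrite memv_linfty wt_bary e.
(* The pole condition is tested on the directions of AB and BC. The result says that the polar form
   of O takes equal values at A, B and C. *)
have := polar 1 (-1) 0; have := polar 0 1 (-1).
rewrite subrr addr0 add0r subrr => /(_ erefl) P23 /(_ erefl) P12.
have {}P12 : (o3 * m5 + o2 * m6) - (o3 * m4 + o1 * m6) = 0.
  by rewrite -P12 /circumform; ring.
have {}P23 : (o3 * m4 + o1 * m6) - (o2 * m4 + o1 * m5) = 0.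
  by rewrite -P23 /circumform; ring.
have n2 : (2 : R) != 0 by rewrite pnatr_eq0.
(* The numerator is that common value. For [m4 = k * u * o1] and [m6 = k * w * o3], the value at B
   is k o1 o3 (u + w) = k o1 o2 o3. *)
pose k := (o3 * m5 + o2 * m6) / (o1 * o2 * o3).
have E4 : m4 = k * (u * o1).
  apply: (mulfI (mulf_neq0 (mulf_neq0 n2 wu) uv)); apply: subr0_eq.
  transitivity (- o2 * 0 - o3 * (0 + 0)); last by ring.
  by rewrite -{1 2}P12 -P23 /k /o1 /o2 /o3; field; rewrite vw wu uv.
have E5 : m5 = k * (v * o2).
  apply: (mulfI (mulf_neq0 (mulf_neq0 n2 vw) uv)); apply: subr0_eq.
  transitivity (o2 * 0 - o3 * (0 + 0)); last by ring.
  by rewrite -{1 2}P12 -P23 /k /o1 /o2 /o3; field; rewrite vw wu uv.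
have E6 : m6 = k * (w * o3).
  apply: (mulfI (mulf_neq0 (mulf_neq0 n2 vw) wu)); apply: subr0_eq.
  transitivity (- o2 * 0 + o3 * (0 + 0)); last by ring.
  by rewrite -{1 2}P12 -P23 /k /o1 /o2 /o3; field; rewrite vw wu uv.
exists k; last first.
  by move=> *; rewrite formM E4 E5 E6 /circumform /o1 /o2 /o3; ring.
apply: contraNneq nA => k0; apply/eqP/(bform_nondegenerate uM) => t.
have [x [y [z ->]]] := bary_surj t.
by rewrite formM E4 E5 E6 k0 /circumform; ring.
Qed.

(** Nonzero coordinates keep H away from the vertices, so the general midpoint formula applies. It
    includes H at infinity, where [s] = 0 and the midpoints with the vertices all become H. *)
Lemma nine_point_conicP (u v w : R) S (s := u + v + w) :
  u != 0 -> v != 0 -> w != 0 ->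
  is_nine_point_conic (pt a) (pt b) (pt c) (bpt u v w) S <->
  [/\ is_conic S,
      [/\ S (bpt 1 1 0), S (bpt 1 0 1) & S (bpt 0 1 1)],
      [/\ S (bpt (s + u) v w), S (bpt u (s + v) w) & S (bpt u v (s + w))] &
      [/\ S (bpt 0 v w), S (bpt u 0 w) & S (bpt u v 0)]].
Proof.
move=> u0 v0 w0; rewrite /is_nine_point_conic.
have -> : midpoint (pt a) (pt b) = bpt 1 1 0 by rewrite midpoint_pt mid_ab.
have -> : midpoint (pt b) (pt c) = bpt 0 1 1 by rewrite midpoint_pt mid_bc.
have -> : midpoint (pt a) (pt c) = bpt 1 0 1.
  by rewrite midpoint_pt -mid_ca /mid addrC.
have h0 : bary u v w != 0 by rewrite bary_neq0 // u0.
have midH x y z : bary x y z != 0 -> bary u v w \notin bpt x y z ->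
    x + y + z = 1 -> midpoint (bpt x y z) (bpt u v w) =
    bpt (s * x + u) (s * y + v) (s * z + w).
  move=> n no e; rewrite midpoint_line //; last first.
    by apply: contraNneq no => ->; rewrite memv_line.
  by rewrite !wt_bary e scale1r baryZ baryD.
have -> : midpoint (pt a) (bpt u v w) = bpt (s + u) v w.
  rewrite ptA midH ?mulr1 ?mulr0 ?add0r ?addr0 ?bary_neq0 ?oner_eq0 //.
  by apply/negP => /memv_bpt[k [_ /eqP + _]]; rewrite mulr0 (negPf v0).
have -> : midpoint (pt b) (bpt u v w) = bpt u (s + v) w.
  rewrite ptB midH ?mulr1 ?mulr0 ?add0r ?addr0 ?bary_neq0 ?oner_eq0 ?orbT //.
  by apply/negP => /memv_bpt[k [/eqP + _ _]]; rewrite mulr0 (negPf u0).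
have -> : midpoint (pt c) (bpt u v w) = bpt u v (s + w).
  rewrite ptC midH ?mulr1 ?mulr0 ?add0r ?addr0 ?bary_neq0 ?oner_eq0 ?orbT //.
  by apply/negP => /memv_bpt[k [/eqP + _ _]]; rewrite mulr0 (negPf u0).
have := @traceA_bary u v w; rewrite v0 => /(_ isT); rewrite /traceA => ->.
have := @traceB_bary u v w; rewrite u0 => /(_ isT); rewrite /traceB => ->.
by have := @traceC_bary u v w; rewrite u0 => /(_ isT); rewrite /traceC => ->.
Qed.

(** The midpoints of the sides express the mixed coefficients through the diagonal ones [m1], [m2],
    [m3]; the other six points force [m1 * u], [m2 * v], [m3 * w] to agree, which leaves one
    factor. *)
Lemma nine_point_conic_form (u v w : R) S (s := u + v + w) :
  u != 0 -> v != 0 -> w != 0 ->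
  is_nine_point_conic (pt a) (pt b) (pt c) (bpt u v w) S ->
  exists M k, [/\ k != 0, conic_form S M & forall x y z,
    bform M (bary x y z) (bary x y z) =
    k * (x * (x - y - z) / u + y * (y - z - x) / v + z * (z - x - y) / w)].
Proof.
move=> u0 v0 w0 /(nine_point_conicP _ u0 v0 w0).
case=> -[M MS] [Sab Sca Sbc] [SA SB SC] [SD SE SF].
have [sM uM ES _] := MS.
set m1 := bform M (bary 1 0 0) (bary 1 0 0).
set m2 := bform M (bary 0 1 0) (bary 0 1 0).
set m3 := bform M (bary 0 0 1) (bary 0 0 1).
set m4 := bform M (bary 0 1 0) (bary 0 0 1).
set m5 := bform M (bary 1 0 0) (bary 0 0 1).
set m6 := bform M (bary 1 0 0) (bary 0 1 0).
have ev x y z : [|| x != 0, y != 0 | z != 0] -> S (bpt x y z) ->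
    x * x * m1 + y * y * m2 + z * z * m3 + 2 * y * z * m4 + 2 * z * x * m5
    + 2 * x * y * m6 = 0.
  rewrite -bary_neq0 => n; rewrite ES => /(conic_points_line _ n).
  by rewrite bform_bary // => <-; rewrite /m1 /m2 /m3 /m4 /m5 /m6; ring.
have n01 : (1 : R) != 0 by exact: oner_neq0.
have {}Sab := ev _ _ _ _ Sab; have {}Sca := ev _ _ _ _ Sca.
have {}Sbc := ev _ _ _ _ Sbc.
have {}SA := ev _ _ _ _ SA; have {}SB := ev _ _ _ _ SB.
have {}SC := ev _ _ _ _ SC; have {}SD := ev _ _ _ _ SD.
have {}SE := ev _ _ _ _ SE; have {}SF := ev _ _ _ _ SF.
move: Sab Sca Sbc SA SB SC SD SE SF; rewrite !n01 u0 v0 w0 !orbT.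
move=> /(_ isT) Sab /(_ isT) Sca /(_ isT) Sbc /(_ isT) SA /(_ isT) SB
  /(_ isT) SC /(_ isT) SD /(_ isT) SE /(_ isT) SF.
have E4 : m4 = - (m2 + m3) / 2.
  by apply/(mulfI (_ : 2 != 0 :> R)); rewrite ?pnatr_eq0 //;
    apply: subr0_eq; rewrite -[RHS]Sbc; field.
have E5 : m5 = - (m3 + m1) / 2.
  by apply/(mulfI (_ : 2 != 0 :> R)); rewrite ?pnatr_eq0 //;
    apply: subr0_eq; rewrite -[RHS]Sca; field.
have E6 : m6 = - (m1 + m2) / 2.
  by apply/(mulfI (_ : 2 != 0 :> R)); rewrite ?pnatr_eq0 //;
    apply: subr0_eq; rewrite -[RHS]Sab; field.
have {}SA : (m1 * u) * (s + u) - (m2 * v) * (w + u) - (m3 * w) * (u + v) = 0.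
  apply/(mulfI (_ : 2 != 0 :> R));
    rewrite ?pnatr_eq0 // mulr0 -[RHS]SA E4 E5 E6 /s.
  by field.
have {}SB : (m2 * v) * (s + v) - (m3 * w) * (u + v) - (m1 * u) * (v + w) = 0.
  apply/(mulfI (_ : 2 != 0 :> R));
    rewrite ?pnatr_eq0 // mulr0 -[RHS]SB E4 E5 E6 /s.
  by field.
have {}SC : (m3 * w) * (s + w) - (m1 * u) * (v + w) - (m2 * v) * (w + u) = 0.
  apply/(mulfI (_ : 2 != 0 :> R));
    rewrite ?pnatr_eq0 // mulr0 -[RHS]SC E4 E5 E6 /s.
  by field.
have {}SD : (v - w) * (m2 * v - m3 * w) = 0.
  by rewrite -[RHS]SD E4 E5 E6; field.
have {}SE : (w - u) * (m3 * w - m1 * u) = 0.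
  by rewrite -[RHS]SE E4 E5 E6; field.
have {}SF : (u - v) * (m1 * u - m2 * v) = 0.
  by rewrite -[RHS]SF E4 E5 E6; field.
have [n12 n13] : m2 * v = m1 * u /\ m3 * w = m1 * u.
  (* If H is at infinity, the midpoints of AH, BH, CH all equal H, and the
     traces of H are needed; otherwise the six midpoints determine the conic. *)
  have [s0 | s0] := eqVneq s 0; last first.
    split; apply: (mulfI (mulf_neq0 (_ : 2 != 0 :> R) s0));
      rewrite ?pnatr_eq0 //; apply: subr0_eq;
      (transitivity (0 - 0 : R); last exact: subr0).
    - by rewrite -{1}SB -SA /s; ring.
    - by rewrite -{1}SC -SA /s; ring.
  have cancel x y : x - y != 0 -> forall t, (x - y) * t = 0 -> t = 0.
    by move=> n t /eqP; rewrite mulf_eq0 (negPf n) => /eqP.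
  have n3 : (3 : R) != 0 by rewrite pnatr_eq0.
  (* Equality of all three would give 3u = [s] = 0. Hence at least two of the differences of u, v, w
     are nonzero, and two trace equations can be cancelled. *)
  have [uv | uv] := eqVneq u v.
    have vw : v - w != 0.
      apply: contraNneq u0 => /subr0_eq vw; apply/eqP; apply: (mulfI n3).
      by rewrite mulr0 -s0 /s -vw uv; ring.
    have wu : w - u != 0 by rewrite uv -opprB oppr_eq0.
    have /subr0_eq e2 := cancel _ _ vw _ SD;
      have /subr0_eq e3 := cancel _ _ wu _ SE.
    by rewrite e2 e3.
  have /subr0_eq e1 : m1 * u - m2 * v = 0 by apply: cancel SF; rewrite subr_eq0.
  rewrite -e1; split=> //.
  have [vw | vw] := eqVneq v w.
    have wu : w - u != 0 by rewrite -vw subr_eq0 eq_sym.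
    by have /subr0_eq := cancel _ _ wu _ SE.
  have /subr0_eq <- : m2 * v - m3 * w = 0 by apply: cancel SD; rewrite subr_eq0.
  by [].
pose k := m1 * u.
have formM x y z : bform M (bary x y z) (bary x y z) =
    k * (x * (x - y - z) / u + y * (y - z - x) / v + z * (z - x - y) / w).
  rewrite bform_bary // -/m1 -/m2 -/m3 -/m4 -/m5 -/m6 E4 E5 E6.
  have -> : m1 = k / u by rewrite /k; field.
  have -> : m2 = k / v by rewrite /k -n12; field.
  have -> : m3 = k / w by rewrite /k -n13; field.
  by field; rewrite u0 v0 w0.
exists M, k; split=> //.
have nA : bary 1 0 0 != 0 by rewrite bary_neq0 oner_neq0.
(* For [k] = 0 the form would vanish on the diagonal, hence everywhere by polarization, against the
   invertibility of [M]. *)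
apply: contraNneq nA => k0; apply/eqP/(bform_nondegenerate uM) => t.
apply: (mulfI (_ : 2 != 0 :> R)); first by rewrite pnatr_eq0.
have [x [y [z ->]]] := bary_surj t.
by rewrite bform_polar // baryD !formM k0; ring.
Qed.

End Barycentric.

(** * The images of the circumconic, and the center of the nine-point conic *)

Section NinePointConic.
Variables (R : realType) (a b c : 'rV[R]_2).
Hypothesis abc : is_triangle a b c.
Local Notation bary := (bary a b c).
Local Notation bpt x y z := <[bary x y z]>%VS.
Variables u v w : R.
Hypotheses (u0 : u != 0) (v0 : v != 0) (w0 : w != 0).
Hypotheses (vw0 : v + w != 0) (wu0 : w + u != 0) (uv0 : u + v != 0).

Let H := bpt u v w.
Let O := bpt (v + w) (w + u) (u + v).

Lemma circumconic_centered_unique : exists M CO,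
  [/\ conic_form CO M, unique (is_circumconic_centered a b c O) CO &
   forall x y z, bform M (bary x y z) (bary x y z) =
     2 * (u * (v + w) * y * z + v * (w + u) * z * x + w * (u + v) * x * y)].
Proof.
have [M [sM uM formM]] := circumconic_exists abc (mulf_neq0 u0 vw0)
  (mulf_neq0 v0 wu0) (mulf_neq0 w0 uv0).
have vtx x y z : x * y = 0 -> y * z = 0 -> z * x = 0 ->
    [|| x != 0, y != 0 | z != 0] -> conic_points M (bpt x y z).
  rewrite -(bary_neq0 abc) => xy yz zx n; apply/conic_points_line => //.
  rewrite formM /circumform; transitivity (2 * u * (v + w) * 0 +
    2 * v * (w + u) * 0 + 2 * w * (u + v) * 0 : R); last by ring.
  by rewrite -{1}yz -{1}zx -xy; ring.
have MA : conic_points M (pt a).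
  by rewrite (ptA a b c); apply: vtx; rewrite ?oner_neq0 ?orbT //; ring.
have MB : conic_points M (pt b).
  by rewrite (ptB a b c); apply: vtx; rewrite ?oner_neq0 ?orbT //; ring.
have MC : conic_points M (pt c).
  by rewrite (ptC a b c); apply: vtx; rewrite ?oner_neq0 ?orbT //; ring.
have MF : conic_form (conic_points M) M by split=> //; exists (pt a).
exists M, (conic_points M); split=> //; last first.
  by move=> x y z; rewrite formM /circumform; ring.
split.
  split=> //; exists M; split=> //; split.
    by apply: is_point_line; rewrite bary_neq0 // vw0.
  move=> _ t /vlineP[k ->]; have [x [y [z ->]]] := bary_surj abc t.
  rewrite memv_linfty wt_bary => /eqP e; apply/bformE.
  rewrite bformZl formM /circumform.
  (* The polar of O has the equation (u + v)(v + w)(w + u)(x + y + z) = 0, so it is the line at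
     infinity. *)
  transitivity (k * (u + v) * (v + w) * (w + u) * 0); last by ring.
  by rewrite -e; ring.
move=> S [SA SB SC [N [NS pole]]].
have [k k0 formN] := circumconic_form abc u0 v0 w0 vw0 wu0 uv0 NS SA SB SC pole.
have [_ _ -> _] := NS; symmetry.
apply: (conic_points_eq k0) => t; have [x [y [z ->]]] := bary_surj abc t.
by rewrite formN formM.
Qed.

Lemma nine_point_conic_eq S S' :
  is_nine_point_conic (pt a) (pt b) (pt c) H S ->
  is_nine_point_conic (pt a) (pt b) (pt c) H S' -> S = S'.
Proof.
move=> /(nine_point_conic_form abc u0 v0 w0)[M [k [k0 [_ _ -> _] formM]]].
move=> /(nine_point_conic_form abc u0 v0 w0)[N [l [l0 [_ _ -> _] formN]]].
apply: (conic_points_eq (mulf_neq0 k0 (invr_neq0 l0))) => t.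
have [x [y [z ->]]] := bary_surj abc t.
by rewrite formM formN; field; rewrite u0 v0 w0 l0.
Qed.

Let circumq x y z : R :=
  u * (v + w) * y * z + v * (w + u) * z * x + w * (u + v) * x * y.

(** Each of the nine points is pulled back to the circumconic, and uniqueness identifies the two
    images. The homothety at H needs an ordinary center, hence the quantification over [h]; the
    image under K also covers H at infinity. *)
Lemma circumconic_nine_point : exists CO,
  unique (is_circumconic_centered a b c O) CO /\ exists NH,
  unique (is_nine_point_conic (pt a) (pt b) (pt c) H) NH /\
  [/\ NH = act (compl a b c) CO,
      forall h : 'rV[R]_2, H = pt h -> NH = act (homothety h 2^-1) CO
    & is_center NH (midpoint H O)].
Proof.
have [M [CO [MCO uCO formM]]] := circumconic_centered_unique.
exists CO; split=> //.
have n2 : (2 : R) != 0 by rewrite pnatr_eq0.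
have k1 : (-1 : R) != 0 by rewrite oppr_eq0 oner_neq0.
have k0 : - 2^-1 != 0 :> R by rewrite oppr_eq0 invr_eq0.
have h0 : 2^-1 != 0 :> R by rewrite invr_eq0.
have conicCO f k : k != 0 -> is_conic (act (homothety f k) CO).
  by move=> n; have [N NS _] := homothety_conic_form f n MCO; exists N.
have actCO f k x y z : k != 0 -> [|| x != 0, y != 0 | z != 0] ->
    forall x' y' z', homothety f k^-1 (bary x y z) = bary x' y' z' ->
    circumq x' y' z' = 0 -> act (homothety f k) CO (bpt x y z).
  move=> n; rewrite -(bary_neq0 abc) => nv x' y' z' e q0.
  apply: (act_homothety_line n MCO) => //; rewrite e formM.
  by rewrite -[X in 2 * X]/(circumq x' y' z') q0 mulr0.
have neq0E := (u0, v0, w0, oner_neq0 R, orbT).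
have nineK : is_nine_point_conic (pt a) (pt b) (pt c) H (act (compl a b c) CO).
  apply/(nine_point_conicP abc) => //.
  have actK x y z : [|| x != 0, y != 0 | z != 0] ->
      circumq (y + z - x) (z + x - y) (x + y - z) = 0 ->
      act (compl a b c) CO (bpt x y z).
    move=> n; apply: actCO => //; rewrite -anticompl_bary invrN invrK //.
  split; first exact: conicCO.
  - by split; apply: actK; rewrite ?neq0E // /circumq; ring.
  - by split; apply: actK; rewrite ?neq0E // /circumq; ring.
  - by split; apply: actK; rewrite ?neq0E // /circumq; ring.
have nineH h : H = pt h ->
    is_nine_point_conic (pt a) (pt b) (pt c) H (act (homothety h 2^-1) CO).
  move=> EH; pose s := u + v + w.
  have : row_mx h 1%:M \in H by rewrite EH memv_line.
  case/vlineP=> l; rewrite baryZ => El.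
  have ls : l * s = 1.
    have : wt (row_mx h (1%:M : 'M[R]_1)) = 1 by rewrite /wt row_mxKr mxE.
    by rewrite El wt_bary => <-; rewrite /s; ring.
  have l0 : l != 0 by apply: contra_eq_neq ls => ->;
    rewrite mul0r eq_sym oner_neq0.
  have s0 : s != 0 by apply: contra_eq_neq ls => ->;
    rewrite mulr0 eq_sym oner_neq0.
  have double t : 2 * t = l * (s * (2 * t)) by rewrite (mulrA l) ls mul1r.
  (* The preimage of a point X is 2X - H, here with denominators cleared by [s]; [t] takes out a
     common factor of its coordinates. *)
  have actH x y z : [|| x != 0, y != 0 | z != 0] -> forall t x' y' z', 
      s * (2 * x) - (x + y + z) * u = t * x' ->
      s * (2 * y) - (x + y + z) * v = t * y' ->
      s * (2 * z) - (x + y + z) * w = t * z' ->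
      circumq x' y' z' = 0 -> act (homothety h 2^-1) CO (bpt x y z).
    move=> n t x' y' z' ex ey ez q0.
    apply: (actCO _ _ _ _ _ h0 n (l * (t * x')) (l * (t * y')) (l * (t * z'))).
      rewrite invrK (homothety_bary _ _ _ _ El) -ex -ey -ez.
      by congr (bary _ _ _); rewrite [X in X + _ = _]double; ring.
    transitivity ((l * t) ^+ 2 * circumq x' y' z'); last by rewrite q0 mulr0.
    by rewrite /circumq; ring.
  apply/(nine_point_conicP abc) => //; split; first exact: conicCO.
  (* The midpoints of the sides come from the reflections of C, B, A in O. *)
  - split.
    + by apply: (@actH _ _ _ _ 2 (v + w) (w + u) (- w));
      rewrite ?neq0E // /circumq /s; ring.
    + by apply: (@actH _ _ _ _ 2 (v + w) (- v) (u + v));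
      rewrite ?neq0E // /circumq /s; ring.
    + by apply: (@actH _ _ _ _ 2 (- u) (w + u) (u + v));
      rewrite ?neq0E // /circumq /s; ring.
  (* The midpoints of AH, BH, CH come from the vertices themselves. *)
  - split.
    + by apply: (@actH _ _ _ _ (2 * s * s) 1 0 0);
      rewrite ?neq0E // /circumq /s; ring.
    + by apply: (@actH _ _ _ _ (2 * s * s) 0 1 0);
      rewrite ?neq0E // /circumq /s; ring.
    + by apply: (@actH _ _ _ _ (2 * s * s) 0 0 1);
      rewrite ?neq0E // /circumq /s; ring.
  (* The traces of H come from points of the circumconic on AH, BH, CH. *)
  - split.
    + by apply: (@actH _ _ _ _ 1 (- (v + w) * u) (v * (s + u)) (w * (s + u)));
        rewrite ?neq0E // /circumq /s; ring.
    + by apply: (@actH _ _ _ _ 1 (u * (s + v)) (- (w + u) * v) (w * (s + v)));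
        rewrite ?neq0E // /circumq /s; ring.
    + by apply: (@actH _ _ _ _ 1 (u * (s + w)) (v * (s + w)) (- (u + v) * w));
        rewrite ?neq0E // /circumq /s; ring.
exists (act (compl a b c) CO); split.
  by split=> // S nS; apply: nine_point_conic_eq.
split=> //; first by move=> h /nineH; apply: nine_point_conic_eq.
have -> : midpoint H O = (compl a b c @: O)%VS.
  have nH : bary u v w != 0 by rewrite bary_neq0 // u0.
  have nO : bary (v + w) (w + u) (u + v) != 0 by rewrite bary_neq0 // vw0.
  rewrite limg_line compl_bary vline_scale //.
  (* For H and O distinct the midpoint formula gives [s] times H + O, and H + O represents K(O).
     Here [s] is nonzero, since [s] = 0 turns (v + w, w + u, u + v) into -(u, v, w). *)
  have [EHO | HO] := eqVneq H O; last first.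
    rewrite midpoint_line // !wt_bary !baryZ baryD.
    have [s0 | s0] := eqVneq (u + v + w) 0; last first.
      by apply: (bpt_eq _ _ _ s0); ring.
    case/eqP: HO; apply: (bpt_eq _ _ _ k1); apply: subr0_eq; rewrite -s0; ring.
  rewrite /midpoint EHO eqxx.
  have : bary (v + w) (w + u) (u + v) \in H by rewrite EHO memv_line.
  case/(memv_bpt abc)=> l [e1 e2 e3].
  (* If H = O, with (v + w, w + u, u + v) = l (u, v, w), then K(O) has coordinates (2 + l)(u, v, w).
     For l = -2 the sum of the equations gives u + v + w = 0, and then u = 0. *)
  have l2 : 2 + l != 0.
    apply: contraNneq u0 => /eqP; rewrite addrC addr_eq0 => /eqP le.
    by move: e1 e2 e3; rewrite le => e1 e2 e3; apply/eqP; lra.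
  rewrite -EHO; apply: (bpt_eq _ _ _ (invr_neq0 l2)); apply: (mulfI l2);
    rewrite mulrA mulfV // mul1r mulrDl -?e1 -?e2 -?e3; ring.
by apply: homothety_center => //; have [[_ _ _]] := uCO.
Qed.

End NinePointConic.

(** * Coordinates of the generalized circumcenter and orthocenter *)

Section GeneralizedCenters.
Variables (R : realType) (a b c : 'rV[R]_2).
Hypothesis abc : is_triangle a b c.
Local Notation bary := (bary a b c).
Local Notation bpt x y z := <[bary x y z]>%VS.
Local Notation is_line := (is_line a b c).

Lemma meet3_lineE (k : R) L M N l1 l2 l3 m1 m2 m3 n1 n2 n3 p q r : k != 0 ->
  is_line L (l1, l2, l3) -> is_line M (m1, m2, m3) -> is_line N (n1, n2, n3) ->
  l2 * m3 - l3 * m2 = k * p -> l3 * m1 - l1 * m3 = k * q ->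
  l1 * m2 - l2 * m1 = k * r -> n1 * p + n2 * q + n3 * r = 0 ->
  [|| p != 0, q != 0 | r != 0] ->
  (L :&: M :&: N)%VS = bpt p q r.
Proof.
move=> k0 Ll Mm Nn ep eq er en n; rewrite (meet_lineE abc k0 Ll Mm ep eq er n).
by apply/capv_idPl; rewrite -memvE Nn /= en.
Qed.

(** The sides of the anticomplementary triangle have the equations y + z = 0, z + x = 0, x + y =
    0. *)
Lemma admissible_bary P : admissible a b c P -> exists x y z,
  [/\ P = bpt x y z, [/\ x != 0, y != 0 & z != 0] &
      [/\ y + z != 0, z + x != 0 & x + y != 0]].
Proof.
case=> pP offABC offanti; have [t _ EP] := is_pointP pP.
have [x [y [z Et]]] := bary_surj abc t; exists x, y, z; split.
- by rewrite EP Et.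
- split; apply/negP=> /eqP e; apply: offABC; rewrite EP Et /on_sides -!memvE.
  + by constructor 1; rewrite (line_bc abc) /= e; apply/eqP; ring.
  + by constructor 2; rewrite (line_ca abc) /= e; apply/eqP; ring.
  + by constructor 3; rewrite (line_ab abc) /= e; apply/eqP; ring.
have n2 : (2 : R) != 0 by rewrite pnatr_eq0.
move: offanti; rewrite (ptA a b c) (ptB a b c) (ptC a b c) !limg_line
  !anticompl_bary => offanti.
(* Here anticompl_bary leaves coordinates such as 1 + 0 - 0 = 1. *)
have lBC : is_line (bpt (1 + 0 - 0) (0 + 0 - 1) (0 + 1 - 0) + bpt (0 + 1 - 0)
  (1 + 0 - 0) (0 + 0 - 1))%VS (0, 1, 1).
  by apply: (join_lineE abc n2); rewrite ?oner_neq0 ?orbT //; ring.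
have lCA : is_line (bpt (0 + 1 - 0) (1 + 0 - 0) (0 + 0 - 1) + bpt (0 + 0 - 1)
  (0 + 1 - 0) (1 + 0 - 0))%VS (1, 0, 1).
  by apply: (join_lineE abc n2); rewrite ?oner_neq0 ?orbT //; ring.
have lAB : is_line (bpt (0 + 0 - 1) (0 + 1 - 0) (1 + 0 - 0) + bpt (1 + 0 - 0)
  (0 + 0 - 1) (0 + 1 - 0))%VS (1, 1, 0).
  by apply: (join_lineE abc n2); rewrite ?oner_neq0 ?orbT //; ring.
split; apply/negP=> /eqP e; apply: offanti; rewrite EP Et /on_sides -!memvE.
- by constructor 1; rewrite lBC; apply/eqP; rewrite -[RHS]e /=; ring.
- by constructor 2; rewrite lCA; apply/eqP; rewrite -[RHS]e /=; ring.
- by constructor 3; rewrite lAB; apply/eqP; rewrite -[RHS]e /=; ring.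
Qed.

Variables x y z : R.
Hypotheses (x0 : x != 0) (y0 : y != 0) (z0 : z != 0).
Hypotheses (yz0 : y + z != 0) (zx0 : z + x != 0) (xy0 : x + y != 0).
Let P := bpt x y z.

(** Reflection in the midpoint of a side swaps the two coordinates on that side, so P' = (1/x : 1/y
    : 1/z) = (yz : zx : xy). *)
Lemma isotomcomplement_bary :
  isotomcomplement a b c P = bpt (x * (y + z)) (y * (z + x)) (z * (x + y)).
Proof.
have n2 : 2^-1 != 0 :> R by rewrite invr_eq0 pnatr_eq0.
have rbc : row_mx (mid b c) 1%:M = bary 0 2^-1 2^-1.
  by rewrite row_mid scalerDr /bary scale0r add0r.
have rca : row_mx (mid c a) 1%:M = bary 2^-1 0 2^-1.
  by rewrite row_mid scalerDr /bary scale0r addr0 addrC.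
have rab : row_mx (mid a b) 1%:M = bary 2^-1 2^-1 0.
  by rewrite row_mid scalerDr /bary scale0r addr0.
have EA : (homothety (mid b c) (- 1) @: bpt 0 y z)%VS = bpt 0 z y.
  rewrite limg_line (homothety_bary _ _ _ _ rbc).
  by apply: (bpt_eq _ _ _ (oner_neq0 R)); field.
have EB : (homothety (mid c a) (- 1) @: bpt x 0 z)%VS = bpt z 0 x.
  rewrite limg_line (homothety_bary _ _ _ _ rca).
  by apply: (bpt_eq _ _ _ (oner_neq0 R)); field.
have EC : (homothety (mid a b) (- 1) @: bpt x y 0)%VS = bpt y x 0.
  rewrite limg_line (homothety_bary _ _ _ _ rab).
  by apply: (bpt_eq _ _ _ (oner_neq0 R)); field.
have EP' : isotomic a b c P = bpt (y * z) (z * x) (x * y).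
  rewrite /isotomic /P (traceA_bary abc) ?y0 // (traceB_bary abc) ?x0 //.
  rewrite (traceC_bary abc) ?x0 // EA EB EC.
  apply: (meet3_lineE (oner_neq0 R) (cevian_a abc _ _) (cevian_b abc _ _)
    (cevian_c abc _ _)); rewrite ?x0 ?y0 ?z0 ?mulf_neq0 //; ring.
rewrite /isotomcomplement EP' limg_line compl_bary vline_scale //.
by apply: (bpt_eq _ _ _ (oner_neq0 R)); ring.
Qed.

Let s := x * y + y * z + z * x.
Let dx := x ^+ 2 - s.
Let dy := y ^+ 2 - s.
Let dz := z ^+ 2 - s.
Let X := x * (y + z) ^+ 2.
Let Y := y * (z + x) ^+ 2.
Let Z := z * (x + y) ^+ 2.

(* (X : y dz : z dy), (x dz : Y : z dx) and (x dy : y dx : Z) are the points at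
   infinity of QD, QE and QF. *)
Let XE : X + y * dz + z * dy = 0. Proof. by rewrite /X /dy /dz /s; ring. Qed.
Let YE : x * dz + Y + z * dx = 0. Proof. by rewrite /Y /dx /dz /s; ring. Qed.
Let ZE : x * dy + y * dx + Z = 0. Proof. by rewrite /Z /dx /dy /s; ring. Qed.

Let X0 : X != 0. Proof. by rewrite mulf_neq0 // expf_neq0. Qed.
Let Y0 : Y != 0. Proof. by rewrite mulf_neq0 // expf_neq0. Qed.
Let Z0 : Z != 0. Proof. by rewrite mulf_neq0 // expf_neq0. Qed.

Let Q := isotomcomplement a b c P.

Let n1 : (1 : R) != 0 := oner_neq0 R.
Let k1 : (-1 : R) != 0. Proof. by rewrite oppr_eq0. Qed.

Lemma infinity_QD : ((Q + traceA a b c P) :&: linfty R)%VS = bpt X (y * dz) (z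
  * dy).
Proof.
rewrite /Q isotomcomplement_bary /P (traceA_bary abc) ?y0 //.
have l : is_line (bpt (x * (y + z)) (y * (z + x)) (z * (x + y)) + bpt 0 y z)%VS
    (y * z * (z - y), - (x * (y + z) * z), x * (y + z) * y).
  by apply: (join_lineE abc n1); [ring | ring | ring |];
    apply/or3P; constructor 3; rewrite !mulf_neq0.
apply: (meet_lineE abc k1 l (linfty_line a b c)); rewrite ?X0 // /X /dz /dy /s;
  ring.
Qed.

Lemma infinity_QE : ((Q + traceB a b c P) :&: linfty R)%VS = bpt (x * dz) Y (z
  * dx).
Proof.
rewrite /Q isotomcomplement_bary /P (traceB_bary abc) ?x0 //.
have l : is_line (bpt (x * (y + z)) (y * (z + x)) (z * (x + y)) + bpt x 0 z)%VS
    (y * (z + x) * z, z * x * (x - z), - (y * (z + x) * x)).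
  by apply: (join_lineE abc n1); [ring | ring | ring |];
    apply/or3P; constructor 1; rewrite !mulf_neq0.
apply: (meet_lineE abc k1 l (linfty_line a b c));
  rewrite ?Y0 ?orbT // /Y /dx /dz /s; ring.
Qed.

Lemma infinity_QF : ((Q + traceC a b c P) :&: linfty R)%VS = bpt (x * dy) (y *
  dx) Z.
Proof.
rewrite /Q isotomcomplement_bary /P (traceC_bary abc) ?x0 //.
have l : is_line (bpt (x * (y + z)) (y * (z + x)) (z * (x + y)) + bpt x y 0)%VS
    (- (z * (x + y) * y), z * (x + y) * x, x * y * (y - x)).
  by apply: (join_lineE abc n1); [ring | ring | ring |];
    apply/or3P; constructor 2; rewrite !mulf_neq0.
apply: (meet_lineE abc k1 l (linfty_line a b c));
  rewrite ?Z0 ?orbT // /Z /dx /dy /s; ring.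
Qed.

Lemma gen_circumcenter_bary : [|| dx != 0, dy != 0 | dz != 0] ->
  gen_circumcenter a b c P = bpt (X * dx) (Y * dy) (Z * dz).
Proof.
move=> ABC.
rewrite /gen_circumcenter /gen_concurrence /parallel_through -/Q.
rewrite infinity_QD infinity_QE infinity_QF.
rewrite (mid_bc a b c) (mid_ca a b c) (mid_ab a b c).
have lA : is_line (bpt 0 1 1 + bpt X (y * dz) (z * dy))%VS
    (z * dy - y * dz, X, - X).
  by apply: (join_lineE abc n1); rewrite ?oppr_eq0 ?X0 ?orbT //; ring.
have lB : is_line (bpt 1 0 1 + bpt (x * dz) Y (z * dx))%VS
    (- Y, x * dz - z * dx, Y).
  by apply: (join_lineE abc n1); rewrite ?oppr_eq0 ?Y0 ?orbT //; ring.
have lC : is_line (bpt 1 1 0 + bpt (x * dy) (y * dx) Z)%VS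
    (Z, - Z, y * dx - x * dy).
  by apply: (join_lineE abc n1); rewrite ?oppr_eq0 ?Z0 ?orbT //; ring.
(* The common factor of the cross product of the first two lines: for instance [YE] turns Y + x dz -
   z dx into -2 z dx. *)
have kz : - (2 * z) != 0 by rewrite oppr_eq0 mulf_neq0 // pnatr_eq0.
apply: (meet3_lineE kz lA lB lC); last first.
- have mul_neq0 (p q : R) : p != 0 -> (p * q != 0) = (q != 0).
    by move=> p0; rewrite mulf_eq0 (negPf p0).
  by rewrite (mul_neq0 X dx X0) (mul_neq0 Y dy Y0) (mul_neq0 Z dz Z0).
all: rewrite ?/X ?/Y ?/Z ?/dx ?/dy ?/dz ?/s; ring.
Qed.

(** By [XE], [YE], [ZE] no two of dx, dy, dz vanish. If dx = 0, then Y = -x dz and Z = -x dy, so O =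
    (0 : Y dy : Z dz) = (0 : 1 : 1); the other cases are cyclic. *)
Lemma gen_circumcenter_midpoints :
  [/\ gen_circumcenter a b c P <> pt (mid b c),
      gen_circumcenter a b c P <> pt (mid c a) &
      gen_circumcenter a b c P <> pt (mid a b)] -> 
  [/\ dx != 0, dy != 0 & dz != 0].
Proof.
have BC : (dy != 0) || (dz != 0).
  rewrite -negb_and; apply: contraNN X0 => /andP[/eqP eB /eqP eC].
  by rewrite -XE eB eC !mulr0 !addr0.
have CA : (dz != 0) || (dx != 0).
  rewrite -negb_and; apply: contraNN Y0 => /andP[/eqP eC /eqP eA].
  by rewrite -YE eA eC !mulr0 !addr0 add0r.
have AB : (dx != 0) || (dy != 0).
  rewrite -negb_and; apply: contraNN Z0 => /andP[/eqP eA /eqP eB].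
  by rewrite -ZE eA eB !mulr0 !add0r.
rewrite gen_circumcenter_bary; last by rewrite orbA AB.
case=> OD OE OF; split; apply/eqP => e.
- apply: OD; rewrite (mid_bc a b c).
  move: BC CA AB; rewrite e eqxx /= orbF => _ nC nB.
  apply: (@bpt_eq _ _ _ _ (- (x * dy * dz)));
    first by rewrite oppr_eq0 !mulf_neq0.
  + by rewrite !mulr0.
  + by rewrite mulr1; apply: subr0_eq; rewrite -[RHS](mulr0 dy) -YE e; ring.
  + by rewrite mulr1; apply: subr0_eq; rewrite -[RHS](mulr0 dz) -ZE e; ring.
- apply: OE; rewrite (mid_ca a b c).
  move: BC CA AB; rewrite e eqxx /= orbF => nC _ nA.
  apply: (@bpt_eq _ _ _ _ (- (y * dz * dx)));
    first by rewrite oppr_eq0 !mulf_neq0.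
  + by rewrite mulr1; apply: subr0_eq; rewrite -[RHS](mulr0 dx) -XE e; ring.
  + by rewrite !mulr0.
  + by rewrite mulr1; apply: subr0_eq; rewrite -[RHS](mulr0 dz) -ZE e; ring.
- apply: OF; rewrite (mid_ab a b c).
  move: BC CA AB; rewrite e eqxx /= orbF => nB nA _.
  apply: (@bpt_eq _ _ _ _ (- (z * dx * dy)));
    first by rewrite oppr_eq0 !mulf_neq0.
  + by rewrite mulr1; apply: subr0_eq; rewrite -[RHS](mulr0 dx) -XE e; ring.
  + by rewrite mulr1; apply: subr0_eq; rewrite -[RHS](mulr0 dy) -YE e; ring.
  + by rewrite !mulr0.
Qed.

Hypotheses (A0 : dx != 0) (B0 : dy != 0) (C0 : dz != 0).

(** The parallel to QD through A is fixed by the ratio y dz : z dy = y/dy : z/dz of the last two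
    coordinates. Cyclically, the three lines meet in (x/dx : y/dy : z/dz). *)
Lemma gen_orthocenter_bary :
  gen_orthocenter a b c P = bpt (x * dy * dz) (y * dz * dx) (z * dx * dy).
Proof.
rewrite /gen_orthocenter /gen_concurrence /parallel_through -/Q.
rewrite infinity_QD infinity_QE infinity_QF.
apply: (meet3_lineE z0 (cevian_a abc _ _) (cevian_b abc _ _) (cevian_c abc _
  _));
  rewrite ?mulf_neq0 //; ring.
Qed.

End GeneralizedCenters.

(** * Specialization to the coordinates of H and O *)

Theorem theorem3p1 (R : realType) (a b c : 'rV[R]_2) (P : flat R)
    (O := gen_circumcenter a b c P) (H := gen_orthocenter a b c P) :
  is_triangle a b c ->
  admissible a b c P ->
  [/\ O <> pt (mid b c), O <> pt (mid c a) & O <> pt (mid a b)] ->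
  [/\ H <> pt a, H <> pt b & H <> pt c] /\
  exists CO, unique (is_circumconic_centered a b c O) CO /\
  exists NH, unique (is_nine_point_conic (pt a) (pt b) (pt c) H) NH /\
  [/\ NH = act (compl a b c) CO,
      forall h : 'rV[R]_2, H = pt h -> NH = act (homothety h 2^-1) CO
    & is_center NH (midpoint H O)].
Proof.
move=> abc /(admissible_bary abc)[x [y [z [EP [x0 y0 z0] [yz zx xy]]]]].
rewrite {}/O {}/H EP => mids.
have [A0 B0 C0] := gen_circumcenter_midpoints abc x0 y0 z0 yz zx xy mids.
rewrite (gen_orthocenter_bary abc x0 y0 z0 yz zx xy A0 B0 C0).
rewrite (gen_circumcenter_bary abc x0 y0 z0 yz zx xy) ?A0 //.
set s := x * y + y * z + z * x in A0 B0 C0 *.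
set dx := x ^+ 2 - s in A0 *; set dy := y ^+ 2 - s in B0 *.
set dz := z ^+ 2 - s in C0 *.
have u0 : x * dy * dz != 0 by rewrite !mulf_neq0.
have v0 : y * dz * dx != 0 by rewrite !mulf_neq0.
have w0 : z * dx * dy != 0 by rewrite !mulf_neq0.
(* With H = (u : v : w) these identities express O = K(H), with factor -1, and show that the
   pairwise sums of u, v, w are nonzero. *)
have Ex : y * dz * dx + z * dx * dy = - (x * (y + z) ^+ 2 * dx).
  by rewrite /dx /dy /dz /s; ring.
have Ey : z * dx * dy + x * dy * dz = - (y * (z + x) ^+ 2 * dy).
  by rewrite /dx /dy /dz /s; ring.
have Ez : x * dy * dz + y * dz * dx = - (z * (x + y) ^+ 2 * dz).
  by rewrite /dx /dy /dz /s; ring.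
split; last first.
  rewrite -(@bpt_eq _ a b c (-1) (y * dz * dx + z * dx * dy) (z * dx * dy + x *
    dy * dz)
    (x * dy * dz + y * dz * dx)) ?Ex ?Ey ?Ez ?mulN1r ?oppr_eq0 ?oner_neq0 //.
  rewrite -Ex -Ey -Ez.
  apply: (circumconic_nine_point abc u0 v0 w0);
    by rewrite ?Ex ?Ey ?Ez oppr_eq0 !mulf_neq0 ?expf_neq0.
(* A point equal to H has no zero coordinate, whereas each vertex has two. *)
have off p q r : bary a b c (x * dy * dz) (y * dz * dx) (z * dx * dy) \in
    <[bary a b c p q r]>%VS -> [/\ p != 0, q != 0 & r != 0].
  case/(memv_bpt abc)=> k [e1 e2 e3]; split.
  - by apply: contraNneq u0 => p0; rewrite e1 p0 mulr0.
  - by apply: contraNneq v0 => q0; rewrite e2 q0 mulr0.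
  - by apply: contraNneq w0 => r0; rewrite e3 r0 mulr0.
rewrite (ptA a b c) (ptB a b c) (ptC a b c).
by split=> e;
  have := off _ _ _ (eq_ind _ (fun L : flat R => _ \in L) (memv_line _) _ e);
  rewrite eqxx; case.
Qed.
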